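(* Let $\mathcal X\subseteq\mathcal H$ be a vector subspace of the Hilbert space $\mathcal H$ equipped with its own norm $\|\cdot\|_{\mathcal X}$. Then: 1. If there is a constant $A>0$ such that for all $f\in\mathcal X$ $$\int_{\mathbb R}x^{-2}\,d\sigma_{f-f^*}(x)\le A\|f\|_{\mathcal X}^2,$$ then for all real $t>s$ $$\|P_{t,s}-P\|_{\mathcal X\to\mathcal H}^2\le B(t-s)^{-2},\qquad\text{where one can take } B=4A.$$ 2. If for some constant $B>0$ the inequality $\|P_{t,s}-P\|_{\mathcal X\to\mathcal H}^2\le B(t-s)^{-2}$ holds for all real $t>s$, then for all $f\in\mathcal X$ $$\int_{\mathbb R}x^{-2}\,d\sigma_{f-f^*}(x)\le A\|f\|_{\mathcal X}^2,\qquad\text{where one can take } A=8B.$$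
   Context: $\mathcal H$ is a complex Hilbert space and $\{U^t\}_{t\in\mathbb R}$ is a strongly continuous group of unitary operators on $\mathcal H$. For $f\in\mathcal H$ and real $t>s$ put $P_{t,s}f=\frac1{t-s}\int_s^tU^\tau f\,d\tau$. $P$ is the orthogonal projection of $\mathcal H$ onto the subspace of vectors fixed by all $U^t$, and $f^*:=Pf$. By Stone's theorem $U^t=e^{it\mathbf B}$ with $\mathbf B$ self-adjoint; let $E$ be its spectral resolution, so that $(U^tf,g)_{\mathcal H}=\int_{\mathbb R}e^{it\lambda}\,d(E(\lambda)f,g)_{\mathcal H}$. For $h\in\mathcal H$, the spectral measure $\sigma_h$ is the finite Borel measure on $\mathbb R$ given by $\sigma_h(C)=\int_C d(E(\lambda)h,h)_{\mathcal H}$. Since $\sigma_{f-f^*}(\{0\})=0$, the value assigned to $x^{-2}$ at $x=0$ is immaterial. For an operator $T$ on $\mathcal H$, $\|T\|_{\mathcal X\to\mathcal H}=\sup_{f\in\mathcal X,\,f\ne0}\|Tf\|_{\mathcal H}/\|f\|_{\mathcal X}$. *)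

(* Defs.v *)
From HB Require Import structures.
From mathcomp Require Import all_boot all_order all_algebra.
From mathcomp Require Import sesquilinear.
From mathcomp Require Import complex.
From mathcomp Require Import all_classical all_reals all_analysis.

Set Implicit Arguments.
Unset Strict Implicit.
Unset Printing Implicit Defensive.

Import Order.TTheory GRing.Theory Num.Theory.
Import numFieldNormedType.Exports.

Local Open Scope classical_set_scope.
Local Open Scope complex_scope.
Local Open Scope ring_scope.

(* A complex Hilbert space is a complete normed space over R[i] with a positive
   definite hermitian form, linear in its first argument, inducing the norm. *)
Record innerProduct (R : realType) (H : completeNormedModType R[i]) :=
  InnerProduct {
    inner :> {dot H for Num.conj} ;
    dot_norm : forall f : H, `|f| ^+ 2 = inner f f }.

Section RealNorm.
Context {R : realType} {H : completeNormedModType R[i]}.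

(* `|f| lives in R[i]; hnorm f is the same number in R (see hnormE). *)
Definition hnorm (f : H) : R := complex.Re `|f|.

Lemma hnormE (f : H) : `|f| = (hnorm f)%:C.
Proof. by rewrite /hnorm RRe_real// ger0_real. Qed.

Lemma hnorm_ge0 (f : H) : 0 <= hnorm f.
Proof. by rewrite -lecR -hnormE; exact: normr_ge0. Qed.

Lemma ler_hnormB (f g : H) : `|hnorm f - hnorm g| <= hnorm (f - g).
Proof.
have h (a b : H) : hnorm a - hnorm b <= hnorm (a - b).
  by rewrite -lecR rmorphB/= -!hnormE; exact: lerB_dist.
by rewrite ler_norml h andbT lerNl opprB (le_trans (h _ _))// /hnorm distrC.
Qed.

End RealNorm.

Section Operators.
Context {R : realType} {H : completeNormedModType R[i]}.
Variable dot : innerProduct H.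

Record orthogonal_projector (Q : H -> H) : Prop := OrthogonalProjector {
  oproj_linear : linear Q ;
  oproj_idem : forall f, Q (Q f) = Q f ;
  oproj_selfadj : forall f g, dot (Q f) g = dot f (Q g) }.

Definition orthogonal_projection_onto (V : set H) (Q : H -> H) : Prop :=
  orthogonal_projector Q /\ range Q = V.

Record unitary_group (U : R -> H -> H) : Prop := UnitaryGroup {
  ugroup_linear : forall t, linear (U t) ;
  ugroup_isometry : forall t f g, dot (U t f) (U t g) = dot f g ;
  ugroup_surj : forall t g, exists f, U t f = g ;
  ugroup0 : forall f, U 0 f = f ;
  ugroupD : forall s t f, U (s + t) f = U s (U t f) ;
  ugroup_continuous : forall f, continuous (U ^~ f) }.

Definition fixed_vectors (U : R -> H -> H) : set H :=
  [set f | forall t, U t f = f].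

(* Resolution of the identity lambda |-> E lambda (that is, E(]-oo, lambda])),
   normalized to be right-continuous in the strong topology. *)
Record spectralFamily := SpectralFamily {
  sfam :> R -> H -> H ;
  sfam_proj : forall l, orthogonal_projector (sfam l) ;
  sfam_min : forall l m f, sfam l (sfam m f) = sfam (Num.min l m) f ;
  sfam_right : forall f l, sfam m f @[m --> l^'+] --> sfam l f ;
  sfam_ninfty : forall f, sfam m f @[m --> -oo] --> (0 : H) ;
  sfam_pinfty : forall f, sfam m f @[m --> +oo] --> f }.

(* (E(lambda) h, h) is real because E(lambda) is self-adjoint. *)
Definition sdistr (E : spectralFamily) (h : H) (l : R) : R :=
  complex.Re (dot (E l h) h).

Lemma sdistrE E h l : sdistr E h l = hnorm (E l h) ^+ 2.
Proof.
have [_ Ei Es] := sfam_proj E l.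
rewrite /sdistr -{1}Ei Es -(dot_norm dot) hnormE.
by rewrite -rmorphXn.
Qed.

Lemma oproj_hnorm_le Q g : orthogonal_projector Q -> hnorm (Q g) <= hnorm g.
Proof.
move=> [_ Qi Qs].
have dE : dot g (Q g) = `|Q g| ^+ 2 by rewrite -Qi -Qs -(dot_norm dot) Qi.
have := dnorm_ge0 dot (g - Q g).
rewrite dnormB dE -!(dot_norm dot) (CrealP _) ?realX ?normr_real//.
rewrite opprD addrA addrK subr_ge0 !hnormE -!rmorphXn lecR.
by rewrite ler_sqr// nnegrE hnorm_ge0.
Qed.

Lemma sdistr_nondecreasing E h : {homo sdistr E h : x y / x <= y}.
Proof.
move=> x y xy; rewrite !sdistrE ler_sqr ?nnegrE ?hnorm_ge0//.
have -> : E x h = E x (E y h) by rewrite sfam_min min_l.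
exact/oproj_hnorm_le/sfam_proj.
Qed.

Lemma sdistr_right_continuous E h : right_continuous (sdistr E h).
Proof.
move=> x; rewrite (_ : sdistr E h = (fun l => hnorm (E l h) ^+ 2)); last first.
  by apply/funext => l; rewrite sdistrE.
have cvgE : hnorm (E l h) @[l --> x^'+] --> hnorm (E x h).
  apply/cvgrPdist_lt => e e0.
  have /cvgrPdist_lt/(_ e%:C) := @sfam_right E h x.
  rewrite ltcR => /(_ e0); apply: filterS => l; rewrite hnormE ltcR.
  exact/le_lt_trans/ler_hnormB.
by under eq_fun do rewrite expr2; rewrite expr2; exact: cvgM.
Qed.

HB.instance Definition _ E h :=
  isCumulative.Build R _ R (sdistr E h)
    (@sdistr_nondecreasing E h) (@sdistr_right_continuous E h).

Definition spectral_measure (E : spectralFamily) (h : H) :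
    {measure set (measurableTypeR R) -> \bar R} :=
  lebesgue_stieltjes_measure (sdistr E h).

(* The integral of phi against the complex measure d(E(lambda) f, g), which by
   polarization is 1/4 \sum_(k < 4) i^k d(E(lambda) (f + i^k g), f + i^k g). *)
Definition spectral_integral (E : spectralFamily) (phi : R -> R) (f g : H)
    : R[i] :=
  4^-1 * \sum_(k < 4) 'i ^+ k *
    (\int[spectral_measure E (f + 'i ^+ k *: g)]_x phi x)%:C.

(* (U^t f, g) is the integral of e^{it lambda} = cos (t lambda) + i sin (t lambda)
   against d(E(lambda) f, g). *)
Definition spectral_resolution_of (U : R -> H -> H) (E : spectralFamily) :=
  forall (t : R) (f g : H),
    dot (U t f) g =
      spectral_integral E (fun x => cos (t * x)) f g +
      'i * spectral_integral E (fun x => sin (t * x)) f g.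

(* The partition is a < s_0 < ... < s_(n-1) = b, with tag c i in its i-th interval. *)
Definition riemann_sum (F : R -> H) (a : R) (s : seq R) (c : nat -> R) : H :=
  \sum_(i < size s) (nth a s i - nth a (a :: s) i)%:C *: F (c i).

Definition is_riemann_integral (F : R -> H) (a b : R) (v : H) : Prop :=
  forall e : R, 0 < e -> exists2 d : R, 0 < d &
    forall (s : seq R) (c : nat -> R),
      itv_partition a b s ->
      (forall i, (i < size s)%N ->
        nth a (a :: s) i <= c i <= nth a s i /\
        nth a s i - nth a (a :: s) i < d) ->
      hnorm (riemann_sum F a s c - v) < e.

Definition riemann_integral (F : R -> H) (a b : R) : H :=
  get (is_riemann_integral F a b).

Definition time_average (U : R -> H -> H) (t s : R) (f : H) : H :=
  ((t - s)^-1)%:C *: riemann_integral (U ^~ f) s t.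

End Operators.

Section SubspaceNorm.
Context {R : realType} {H : completeNormedModType R[i]}.

Record norm_on (X : {pred H}) (nX : H -> R) : Prop := NormOn {
  norm_on_ge0 : {in X, forall f, 0 <= nX f} ;
  norm_on_eq0 : {in X, forall f, nX f = 0 -> f = 0} ;
  norm_onZ : forall a : R[i], {in X, forall f, nX (a *: f) = complex.Re `|a| * nX f} ;
  norm_onD : {in X &, forall f g, nX (f + g) <= nX f + nX g} }.

(* The supremum is taken in [0, +oo], whence the added 0, which matters only
   when X is the zero subspace. *)
Definition opnorm (X : {pred H}) (nX : H -> R) (T : H -> H) : \bar R :=
  ereal_sup ([set 0%E] `|`
    [set (hnorm (T f) / nX f)%:E | f in [set f | f \in X /\ f != 0]]).

End SubspaceNorm.

(* Main.v *)
From HB Require Import structures.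
Require Import Defs.
From mathcomp Require Import all_boot all_order all_algebra.
From mathcomp Require Import sesquilinear.
From mathcomp Require Import complex.
From mathcomp Require Import all_classical all_reals all_analysis.
From mathcomp Require Import measurable_realfun.
From mathcomp Require Import ring lra.

Import Order.TTheory GRing.Theory Num.Theory.
Import numFieldNormedType.Exports.

Local Open Scope classical_set_scope.
Local Open Scope complex_scope.
Local Open Scope ring_scope.

(** Write [h = f - P f] and [T = t - s]. Since the group fixes [P f], the vector
[T * (P_{t,s} f - P f)] is the integral of [U^tau h] over [[s, t]], and the
spectral representation turns its squared norm into the integral of
[|int_s^t e^{i tau x} dtau|^2] against the spectral measure of [h]. That
function of [x] is [fejer_kernel T x], which is [2 (1 - cos (T x)) / x^2] off
the origin and [T^2] at the origin. The resulting identity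
[sqr_hnorm_time_average] makes both inequalities statements about one kernel.

The identity is proved on finite sums. By [sqr_hnorm_wave], the squared norm of
[sum_j w_j U^{c_j} h] is the integral of [|sum_j w_j e^{i c_j x}|^2], because
[Re (U^t h, h)] is the integral of [cos (t x)] ([rdotU_cos]). For a Riemann sum
of mesh [d] the scalar sum inside is at distance at most [|x| d (b - a)] from
the integral of [e^{i tau x}] in each coordinate ([tcos_error],
[tsin_error]); dominated convergence then yields both the existence of the
vector-valued Riemann integral and the value of its norm.

For the first inequality, the kernel is at most [4 / x^2] off the origin, and
the origin is not charged: the jump at [0] of the spectral family, applied to
[h], is a vector fixed by the group, and [h] is orthogonal to all of these
([spectral_measure_set0]).

For the second inequality, the hypothesis bounds the integral of
[fejer_kernel T] by the same constant [B ||f||_X^2] for every [T > 0]. Averaging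
over [T = k / (n + 1)] with [1 <= k <= (n + 1)^2] makes the mean of
[1 - cos (T x)] tend to [1] at every [x <> 0], since the mesh goes to [0] while
the range of [T] goes to infinity. Fatou's lemma then bounds the integral of
[2 / x^2] by [B ||f||_X^2], which is better than the constant asked for
([integral_exprN2_le]). *)

(** * Real inner product and norm of a complex Hilbert space *)

Lemma ReD {R : realType} (x y : R[i]) :
  complex.Re (x + y) = complex.Re x + complex.Re y.
Proof. by case: x => ? ?; case: y. Qed.

Lemma ReN {R : realType} (x : R[i]) : complex.Re (- x) = - complex.Re x.
Proof. by case: x. Qed.

Section LinearPredicate.
Context {K : nzRingType} {V W : lmodType K} (T : V -> W).
Hypothesis lT : linear T.

Let linT : {linear V -> W} := HB.pack T (GRing.isLinear.Build _ _ _ _ T lT).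

Lemma linear_predB f g : T (f - g) = T f - T g.
Proof. exact: (linearB linT). Qed.

Lemma linear_predZ a f : T (a *: f) = a *: T f.
Proof. exact: (linearZ_LR linT). Qed.

End LinearPredicate.
Arguments linear_predB {K V W T} lT f g.
Arguments linear_predZ {K V W T} lT a f.

Section RealInnerProduct.
Context {R : realType} {H : completeNormedModType R[i]}.
Variable dot : innerProduct H.
Implicit Types f g h : H.

(** Every norm computation below involves only real parts of inner products, and
these form a real bilinear symmetric form. *)
Definition rdot f g : R := complex.Re (dot f g).

Lemma rdotDl f g h : rdot (f + g) h = rdot f h + rdot g h.
Proof. by rewrite /rdot linearDl ReD. Qed.

Lemma rdotDr f g h : rdot h (f + g) = rdot h f + rdot h g.
Proof. by rewrite /rdot linearDr ReD. Qed.

Lemma rdotNr f g : rdot f (- g) = - rdot f g.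
Proof. by rewrite /rdot linearNr ReN. Qed.

Lemma rdotNl f g : rdot (- f) g = - rdot f g.
Proof. by rewrite /rdot linearNl ReN. Qed.

Lemma rdot0l f : rdot 0 f = 0.
Proof. by rewrite /rdot linear0l. Qed.

Lemma rdot0r f : rdot f 0 = 0.
Proof. by rewrite /rdot linear0r. Qed.

Lemma rdotC f g : rdot f g = rdot g f.
Proof.
by apply: complexI; rewrite /rdot hermC expr0 mul1r !complexRe Re_conj.
Qed.

Lemma rdotZl a f g : rdot (a%:C *: f) g = a * rdot f g.
Proof.
rewrite /rdot linearZl_LR/=; case: (dot f g) => x y /=.
by rewrite mul0r subr0.
Qed.

Lemma rdotZr a f g : rdot f (a%:C *: g) = a * rdot f g.
Proof. by rewrite rdotC rdotZl rdotC. Qed.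

Lemma rdotff f : rdot f f = hnorm f ^+ 2.
Proof. by rewrite /rdot -(dot_norm dot) hnormE -rmorphXn. Qed.

Lemma sqr_hnormB f g :
  hnorm (f - g) ^+ 2 = hnorm f ^+ 2 + hnorm g ^+ 2 - 2 * rdot f g.
Proof. by rewrite -!rdotff rdotDl !rdotDr !rdotNl !rdotNr (rdotC g f); ring. Qed.

Lemma rdot_sumlr (I J : Type) (r : seq I) (s : seq J) (F : I -> H) (G : J -> H) :
  rdot (\sum_(i <- r) F i) (\sum_(j <- s) G j) =
  \sum_(i <- r) \sum_(j <- s) rdot (F i) (G j).
Proof.
rewrite (big_morph (rdot^~ _) (fun f g => rdotDl f g _) (rdot0l _)).
apply: eq_bigr => i _.
by rewrite (big_morph (rdot (F i)) (fun f g => rdotDr f g _) (rdot0r _)).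
Qed.

End RealInnerProduct.

Section RealNormTheory.
Context {R : realType} {H : completeNormedModType R[i]}.
Implicit Types f g : H.

Lemma hnorm0 : hnorm (0 : H) = 0.
Proof. by rewrite /hnorm normr0. Qed.

Lemma hnorm0_eq0 f : hnorm f = 0 -> f = 0.
Proof. by move=> f0; apply/normr0_eq0; rewrite hnormE f0. Qed.

Lemma hnormZ a f : hnorm (a%:C *: f) = `|a| * hnorm f.
Proof.
apply: complexI; rewrite rmorphM/= -!hnormE normrZ; congr (_ * _).
by rewrite normc_def/= expr0n addr0 sqrtr_sqr.
Qed.

Lemma hnormD_le f g : hnorm (f + g) <= hnorm f + hnorm g.
Proof. by rewrite -lecR rmorphD/= -!hnormE ler_normD. Qed.

Lemma hnormBC f g : hnorm (f - g) = hnorm (g - f).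
Proof. by rewrite /hnorm distrC. Qed.

Lemma cvg_hnormP (u : nat -> H) f :
  u n @[n --> \oo] --> f <-> hnorm (u n - f) @[n --> \oo] --> 0.
Proof.
split=> [/cvgrPdist_lt uf|/cvgrPdist_lt uf].
  apply/cvgrPdist_lt => e e0.
  have /uf : 0 < e%:C by rewrite ltcR.
  apply: filterS => n.
  by rewrite hnormE ltcR sub0r normrN ger0_norm ?hnorm_ge0// hnormBC.
apply/cvgrPdist_lt => e e0.
have eE : e = (complex.Re e)%:C by rewrite RRe_real// gtr0_real.
move: e0; rewrite eE ltcR => /uf; apply: filterS => n.
by rewrite hnormE ltcR sub0r normrN ger0_norm ?hnorm_ge0// hnormBC.
Qed.

Lemma cvg_hnorm (u : nat -> H) f :
  hnorm (u n - f) @[n --> \oo] --> 0 -> hnorm (u n) @[n --> \oo] --> hnorm f.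
Proof.
move=> /cvgrPdist_lt uf; apply/cvgrPdist_lt => e /uf; apply: filterS => n.
rewrite sub0r normrN ger0_norm ?hnorm_ge0//.
by apply: le_lt_trans; rewrite hnormBC ler_hnormB.
Qed.

Lemma hnorm_complete (u : nat -> H) :
  (forall e, 0 < e -> exists N, forall m n, (N <= m)%N -> (N <= n)%N ->
     hnorm (u m - u n) < e) ->
  exists f, hnorm (u n - f) @[n --> \oo] --> 0.
Proof.
move=> uC; suff /cvg_ex[f /cvg_hnormP uf] : cvg (u n @[n --> \oo]) by exists f.
apply/cauchy_cvgP/cauchyP => e e0.
have eE : e = (complex.Re e)%:C by rewrite RRe_real// gtr0_real.
have /uC[N uN] : 0 < complex.Re e by rewrite -ltcR -eE.
exists (u N), N => // n /= Nn.
by rewrite -ball_normE/= eE hnormE ltcR uN.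
Qed.

End RealNormTheory.

(** * Spectral measures *)

Section BoundedConvergence.
Context {R : realType} (mu : {measure set (measurableTypeR R) -> \bar R}).
Hypothesis mu_fin : (mu setT < +oo)%E.
Implicit Types (f : R -> R) (M : R).

Lemma bounded_integrable f M : measurable_fun setT f ->
  (forall x, `|f x| <= M) -> mu.-integrable setT (EFin \o f).
Proof.
move=> mf fM; apply: measurable_bounded_integrable => //.
exists M; split; first exact: num_real.
by move=> x Mx y _; exact: le_trans (fM y) (ltW Mx).
Qed.

(** Dominated convergence with a constant majorant, on a finite measure. *)
Lemma bounded_cvg_integral (F : nat -> R -> R) f M :
  (forall n, measurable_fun setT (F n)) -> measurable_fun setT f ->
  (forall n x, `|F n x| <= M) -> (forall x, F n x @[n --> \oo] --> f x) ->
  (\int[mu]_x (F n x)%:E @[n --> \oo] --> \int[mu]_x (f x)%:E)%E.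
Proof.
move=> mF mf FM Ff.
have [//|//|||//|_ _ /=] := @dominated_convergence _ _ _ mu setT measurableT
  (fun n x => (F n x)%:E) (fun x => (f x)%:E) (cst M%:E).
- by move=> n; apply/measurable_EFinP; exact: mF.
- by apply/measurable_EFinP; exact: mf.
- by apply: aeW => x _; apply/cvg_EFin => //; [exact: nearW|exact: Ff].
- apply: (@bounded_integrable (cst M) `|M|) => // x.
- by apply: aeW => x n _; rewrite abse_EFin lee_fin.
- by [].
Qed.

End BoundedConvergence.

(** Pairing the terms with [i^0, i^2] and those with [i^1, i^3] separates the real
and imaginary parts. *)
Lemma polarization_sumE {R : realType} (I : nat -> R) :
  4^-1 * \sum_(k < 4) 'i ^+ k * (I k)%:C =
    (4^-1 * (I 0%N - I 2%N)) +i* (4^-1 * (I 1%N - I 3%N)) :> R[i].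
Proof.
rewrite !big_ord_recl big_ord0 /= /bump/= !add1n !exprS !expr0.
rewrite -complexiE (_ : 4^-1 = (4^-1)%:C :> R[i]); last first.
  by rewrite fmorphV/= rmorph_nat.
by apply/eqP; rewrite eq_complex /=; apply/andP; split; apply/eqP; ring.
Qed.

Section SpectralMeasure.
Context {R : realType} {H : completeNormedModType R[i]}.
Variables (dot : innerProduct H) (E : spectralFamily dot).
Implicit Types (f g h : H) (a b l : R).

Lemma spectral_measure_itv h a b : a <= b ->
  spectral_measure E h `]a, b]%classic = (sdistr E h b - sdistr E h a)%:E.
Proof.
move=> ab; rewrite /spectral_measure/= /lebesgue_stieltjes_measure.
rewrite /measure_extension measurable_mu_extE/=; last exact: is_ocitv.
by rewrite wlength_itv_bnd.
Qed.

Lemma sdistr_ge0 h l : 0 <= sdistr E h l.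
Proof. by rewrite sdistrE sqr_ge0. Qed.

Lemma sdistr_le h l : sdistr E h l <= hnorm h ^+ 2.
Proof.
rewrite sdistrE ler_sqr ?nnegrE ?hnorm_ge0//.
exact/oproj_hnorm_le/sfam_proj.
Qed.

(** The mass of [`]-n, n]] is an increment of the distribution function, which takes
its values between [0] and [||h||^2]. *)
Lemma spectral_measureT_le h :
  (spectral_measure E h setT <= (hnorm h ^+ 2)%:E)%E.
Proof.
rewrite -(bigcup_itvT false false).
pose I n : set R := `]- (n%:R), n%:R]%classic.
have cI : spectral_measure E h (I n) @[n --> \oo] -->
    spectral_measure E h (\bigcup_n I n).
  apply: nondecreasing_cvg_mu; rewrite /I//; first exact: bigcup_measurable.
  by move=> *; apply/subsetPset/subset_itv; rewrite leBSide/= ?lerN2 ler_nat.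
rewrite -(cvg_lim _ cI)//; apply: lime_le; first by apply/cvg_ex; eexists; exact: cI.
apply: nearW => n; rewrite spectral_measure_itv ?ge0_cp// lee_fin.
by rewrite lerBlDr (le_trans (sdistr_le h _))// lerDl sdistr_ge0.
Qed.

Lemma spectral_measure_fin h : (spectral_measure E h setT < +oo)%E.
Proof. exact: le_lt_trans (spectral_measureT_le h) (ltry _). Qed.

(** The spectral measure of the zero vector has total mass at most [0]. *)
Lemma integral_spectral_measure0 (phi : R -> \bar R) :
  (\int[spectral_measure E 0%R]_x phi x = 0)%E.
Proof.
rewrite (@eq_measure_integral _ _ _ _ mzero) ?integral_measure_zero// => A mA _.
apply/eqP; rewrite -measure_le0 (le_trans (le_measure _ _ _ (@subsetT _ A)))//.
- by rewrite inE.
- by rewrite inE.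
- by rewrite (le_trans (spectral_measureT_le _))// hnorm0 expr0n.
Qed.

(** Polarizing at the pair [(h/2, h/2)] makes the spectral measure of [h] itself
appear, with no need to compare spectral measures of proportional vectors. *)
Lemma spectral_integral_half phi h :
  let k := (2^-1)%:C *: h in
  spectral_integral E phi k k =
    (4^-1 * \int[spectral_measure E h]_x phi x) +i*
    (4^-1 * (\int[spectral_measure E (k + 'i *: k)]_x phi x -
             \int[spectral_measure E (k - 'i *: k)]_x phi x)).
Proof.
move=> k; pose I j := \int[spectral_measure E (k + 'i%R ^+ j *: k)]_x phi x.
rewrite /spectral_integral (polarization_sumE I) /I.
have -> : k + 'i%R ^+ 0 *: k = h.
  rewrite expr0 scale1r -scalerDl -rmorphD/= (_ : 2^-1 + 2^-1 = 1 :> R).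
    by rewrite scale1r.
  by lra.
have -> : k + 'i%R ^+ 2 *: k = 0 by rewrite sqrCi scaleN1r subrr.
have -> : k + 'i%R ^+ 3 *: k = k - 'i *: k.
  by rewrite exprS sqrCi mulrN1 scaleNr.
have I0 : \int[spectral_measure E 0%R]_x phi x = 0.
  by rewrite /Rintegral integral_spectral_measure0.
by rewrite I0 expr1; congr (4^-1 * _ +i* _); rewrite subr0.
Qed.

End SpectralMeasure.

(** * Norms of finite combinations of orbit vectors *)

Lemma measurable_cosM {R : realType} (t : R) :
  measurable_fun setT (fun x : R => cos (t * x)).
Proof.
apply: continuous_measurable_fun => x.
apply: continuous_comp; last exact: continuous_cos.
exact: mulrl_continuous.
Qed.

Lemma measurable_sinM {R : realType} (t : R) :
  measurable_fun setT (fun x : R => sin (t * x)).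
Proof.
apply: continuous_measurable_fun => x.
apply: continuous_comp; last exact: continuous_sin.
exact: mulrl_continuous.
Qed.

Lemma normr_cos_le1 {R : realType} (x : R) : `|cos x| <= 1.
Proof. by rewrite ler_norml cos_geN1 cos_le1. Qed.

Lemma normr_sin_le1 {R : realType} (x : R) : `|sin x| <= 1.
Proof. by rewrite ler_norml sin_geN1 sin_le1. Qed.

Lemma Rintegral_sum {R : realType} (mu : {measure set (measurableTypeR R) -> \bar R})
    (I : Type) (r : seq I) (F : I -> R -> R) :
  (forall i, mu.-integrable setT (EFin \o F i)) ->
  \int[mu]_x (\sum_(i <- r) F i x) = \sum_(i <- r) \int[mu]_x F i x.
Proof.
move=> iF; elim: r => [|i r IH].
  rewrite big_nil /Rintegral; under eq_integral do rewrite big_nil.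
  by rewrite integral0.
rewrite big_cons -IH -RintegralD//.
  by apply: eq_Rintegral => x _; rewrite big_cons.
rewrite [EFin \o _](_ : _ = (fun x => \sum_(j <- r) (F j x)%:E)%E).
  by apply: integrable_sum => // j _; exact: iF.
by apply/funext => x; rewrite /= sumEFin.
Qed.

Section TrigonometricPolynomial.
Context {R : realType}.
Implicit Types (p : seq (R * R)) (x : R).

(** A list of pairs [(w, c)] encodes the trigonometric polynomial [sum w e^{i c x}];
[tcos] and [tsin] are its real and imaginary parts. *)
Definition tcos p x := \sum_(z <- p) z.1 * cos (z.2 * x).
Definition tsin p x := \sum_(z <- p) z.1 * sin (z.2 * x).

Lemma measurable_tcos p : measurable_fun setT (tcos p).
Proof.
apply: measurable_sum => z.
by apply: measurable_funM => //; exact: measurable_cosM.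
Qed.

Lemma measurable_tsin p : measurable_fun setT (tsin p).
Proof.
apply: measurable_sum => z.
by apply: measurable_funM => //; exact: measurable_sinM.
Qed.

Lemma normr_tcos_le p x : `|tcos p x| <= \sum_(z <- p) `|z.1|.
Proof.
apply: (le_trans (ler_norm_sum _ _ _)); apply: ler_sum => z _.
by rewrite normrM ler_piMr// normr_cos_le1.
Qed.

Lemma normr_tsin_le p x : `|tsin p x| <= \sum_(z <- p) `|z.1|.
Proof.
apply: (le_trans (ler_norm_sum _ _ _)); apply: ler_sum => z _.
by rewrite normrM ler_piMr// normr_sin_le1.
Qed.

Definition tsq p x := tcos p x ^+ 2 + tsin p x ^+ 2.

Lemma tsq_ge0 p x : 0 <= tsq p x.
Proof. by rewrite addr_ge0 ?sqr_ge0. Qed.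

Lemma measurable_tsq p : measurable_fun setT (tsq p).
Proof.
apply: measurable_funD; apply: measurable_funX.
  exact: measurable_tcos.
exact: measurable_tsin.
Qed.

Lemma tsq_le p x : tsq p x <= 2 * (\sum_(z <- p) `|z.1|) ^+ 2.
Proof.
rewrite mulr_natl mulr2n lerD//.
  by rewrite -(real_normK (num_real (tcos _ _))) ler_pXn2r ?nnegrE ?normr_tcos_le ?sumr_ge0.
by rewrite -(real_normK (num_real (tsin _ _))) ler_pXn2r ?nnegrE ?normr_tsin_le ?sumr_ge0.
Qed.

Lemma tsqE p x :
  tsq p x = \sum_(z <- p) \sum_(w <- p) (z.1 * w.1) * cos ((z.2 - w.2) * x).
Proof.
rewrite /tsq !expr2 !mulr_suml -big_split/=; apply: eq_bigr => z _.
rewrite !mulr_sumr -big_split/=; apply: eq_bigr => w _.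
by rewrite mulrBl cosB; ring.
Qed.

End TrigonometricPolynomial.

Section UnitaryGroup.
Context {R : realType} {H : completeNormedModType R[i]}.
Variables (dot : innerProduct H) (U : R -> H -> H) (E : spectralFamily dot).
Hypotheses (hU : unitary_group dot U) (hE : spectral_resolution_of U E).
Implicit Types (f g h : H) (t s : R) (p : seq (R * R)).

Lemma rdotUU t s h : rdot dot (U t h) (U s h) = rdot dot (U (t - s) h) h.
Proof.
have {1}-> : t = s + (t - s) by ring.
by rewrite (ugroupD hU) /rdot (ugroup_isometry hU).
Qed.

Lemma integrable_cosM h t :
  (spectral_measure E h).-integrable setT (EFin \o (fun x => cos (t * x))).
Proof.
apply: (@bounded_integrable _ _ (spectral_measure_fin _ _ _) _ 1).
  exact: measurable_cosM.
by move=> x; exact: normr_cos_le1.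
Qed.

Lemma Rintegral_sinN h t :
  \int[spectral_measure E h]_x sin (- t * x) =
  - \int[spectral_measure E h]_x sin (t * x).
Proof.
transitivity (\int[spectral_measure E h]_x (-1 * sin (t * x))).
  by apply: eq_Rintegral => x _; rewrite mulN1r mulNr sinN.
rewrite RintegralZl ?mulN1r//.
apply: (@bounded_integrable _ _ (spectral_measure_fin _ _ _) _ 1).
  exact: measurable_sinM.
by move=> x; exact: normr_sin_le1.
Qed.

(** The sine terms coming from polarization are odd in [t], whereas
[Re (U^t h, h)] is even because [U^{-t}] is the adjoint of [U^t]. They therefore
vanish, and only the cosine term survives. *)
Lemma rdotU_cos t h :
  rdot dot (U t h) h = \int[spectral_measure E h]_x cos (t * x).
Proof.
pose k := (2^-1)%:C *: h.
pose S t := \int[spectral_measure E (k + 'i *: k)]_x sin (t * x) -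
            \int[spectral_measure E (k - 'i *: k)]_x sin (t * x).
pose C := \int[spectral_measure E h]_x cos (t * x).
have vE u : rdot dot (U u k) k =
    4^-1 * \int[spectral_measure E h]_x cos (u * x) - 4^-1 * S u.
  rewrite /rdot hE !spectral_integral_half ReD; congr (_ + _).
  rewrite -complexiE /S /k /=.
  by rewrite mul0r mul1r sub0r.
have vN : rdot dot (U (- t) k) k = rdot dot (U t k) k.
  by rewrite -(sub0r t) -rdotUU (ugroup0 hU) rdotC.
have SN : S (- t) = - S t by rewrite /S !Rintegral_sinN opprB opprK addrC.
have CN : \int[spectral_measure E h]_x cos (- t * x) = C.
  by apply: eq_Rintegral => x _; rewrite mulNr cosN.
have hk : h = 2%:C *: k by rewrite scalerA -rmorphM/= divff// scale1r.
rewrite {1 2}hk (linear_predZ (ugroup_linear hU t)) rdotZl rdotZr vE -/C.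
move: vN; rewrite vE (vE t) SN CN -/C.
lra.
Qed.

(** The vector whose spectral counterpart is the trigonometric polynomial [p]. *)
Definition wave p h : H := \sum_(z <- p) z.1%:C *: U z.2 h.

(** Expanding both sides gives double sums; their terms match by [rdotU_cos], as
[Re (U^c h, U^{c'} h) = Re (U^{c - c'} h, h)]. *)
Lemma sqr_hnorm_wave p h :
  ((hnorm (wave p h) ^+ 2)%:E = \int[spectral_measure E h]_x (tsq p x)%:E)%E.
Proof.
have -> : hnorm (wave p h) ^+ 2 = \int[spectral_measure E h]_x tsq p x.
  rewrite -(rdotff dot) rdot_sumlr.
  under eq_Rintegral do rewrite tsqE.
  have int1 z w : (spectral_measure E h).-integrable setT
      (EFin \o (fun x => (z.1 * w.1) * cos ((z.2 - w.2) * x))).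
    apply: (@bounded_integrable _ _ (spectral_measure_fin _ _ _) _ `|z.1 * w.1|).
      by apply: measurable_funM => //; exact: measurable_cosM.
    by move=> x; rewrite normrM ler_piMr// normr_cos_le1.
  rewrite Rintegral_sum; last first.
    move=> z; rewrite [EFin \o _](_ : _ = (fun x =>
        \sum_(w <- p) ((z.1 * w.1) * cos ((z.2 - w.2) * x))%:E)%E).
      by apply: integrable_sum => // w _; exact: int1.
    by apply/funext => x; rewrite /= sumEFin.
  apply: eq_bigr => z _; rewrite Rintegral_sum//; apply: eq_bigr => w _.
  rewrite RintegralZl//; last exact: integrable_cosM.
  by rewrite rdotZl rdotZr mulrA rdotUU rdotU_cos.
rewrite /Rintegral fineK//; apply: integrable_fin_num => //.
apply: (@bounded_integrable _ _ (spectral_measure_fin _ _ _) _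
    (2 * (\sum_(z <- p) `|z.1|) ^+ 2)).
  exact: measurable_tsq.
by move=> x; rewrite ger0_norm ?tsq_ge0// tsq_le.
Qed.

End UnitaryGroup.

(** * Scalar Riemann sums of cosine and sine *)

Section RiemannSumError.
Context {R : realType}.
Implicit Types (a b d v w x : R).

Lemma ler_dist_cos v w : `|cos v - cos w| <= `|v - w|.
Proof.
wlog vw : v w / v <= w.
  by move=> h; have [/h//|/ltW/h] := leP v w; rewrite distrC (distrC w).
have [z _ zE] : exists2 z, z \in `[v, w] & cos w - cos v = - sin z * (w - v).
  apply: (@MVT_segment R cos (fun x => - sin x)) => //.
  by apply: continuous_subspaceT => x; exact: continuous_cos.
by rewrite distrC (distrC v) zE normrM normrN ler_piMl// normr_sin_le1.
Qed.

Lemma ler_dist_sin v w : `|sin v - sin w| <= `|v - w|.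
Proof.
wlog vw : v w / v <= w.
  by move=> h; have [/h//|/ltW/h] := leP v w; rewrite distrC (distrC w).
have [z _ zE] : exists2 z, z \in `[v, w] & sin w - sin v = cos z * (w - v).
  apply: (@MVT_segment R sin (fun x => cos x)) => //.
  by apply: continuous_subspaceT => x; exact: continuous_sin.
by rewrite distrC (distrC v) zE normrM ler_piMl// normr_cos_le1.
Qed.

(** Antiderivatives in [t] of [cos (t x)] and [sin (t x)] that remain valid at
[x = 0]. For [sinI] this relies on [0^-1 = 0]. *)
Definition cosI x t := if x == 0 then t else sin (t * x) / x.
Definition sinI x t := - cos (t * x) / x.

(** By the mean value theorem the increment of [F] is [w - v] times [f (z x)] for an
intermediate [z], and moving [z] to the tag costs at most [|x| (w - v)]. *)
Lemma tagged_increment (F f : R -> R) (x t v w : R) :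
  (forall y : R, is_derive y (1 : R) F (f (y * x))) ->
  (forall y z, `|f y - f z| <= `|y - z|) ->
  v <= t <= w -> `|F w - F v - (w - v) * f (t * x)| <= `|x| * (w - v) ^+ 2.
Proof.
move=> dF fL /andP[vt tw]; have vw := le_trans vt tw.
have [z] : exists2 z, z \in `[v, w] & F w - F v = f (z * x) * (w - v).
  apply: (@MVT_segment R F (fun y => f (y * x))) => //.
  apply: continuous_subspaceT => y.
  apply/differentiable_continuous/derivable1_diffP.
  by apply: ex_derive; exact: dF.
rewrite in_itv/= => /andP[vz zw] ->.
rewrite mulrC -mulrBr normrM (ger0_norm (_ : 0 <= w - v)) ?subr_ge0//.
rewrite expr2 mulrCA ler_wpM2l ?subr_ge0// (le_trans (fL _ _))//.
rewrite -mulrBl normrM mulrC ler_wpM2l// ler_norml.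
by apply/andP; split; lra.
Qed.

Lemma is_derive_cosI x y : is_derive y (1 : R) (cosI x) (cos (y * x)).
Proof.
have [->|x0] := eqVneq x 0.
  rewrite (_ : cosI 0 = id); last by apply/funext => t; rewrite /cosI eqxx.
  by rewrite mulr0 cos0; exact: is_derive_id.
rewrite (_ : cosI x = (fun t => x^-1 *: (sin \o *%R^~ x) t)); last first.
  by apply/funext => t; rewrite /cosI (negbTE x0) mulrC.
apply: is_derive_eq.
by rewrite /= /GRing.scale/=; field.
Qed.

Lemma is_derive_sinI x y : is_derive y (1 : R) (sinI x) (sin (y * x)).
Proof.
have [->|x0] := eqVneq x 0.
  rewrite (_ : sinI 0 = cst 0); last by apply/funext => t; rewrite /sinI invr0 mulr0.
  by rewrite mulr0 sin0; exact: is_derive_cst.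
rewrite (_ : sinI x = (fun t => - x^-1 *: (cos \o *%R^~ x) t)); last first.
  by apply/funext => t; rewrite /sinI /GRing.scale/= mulNr mulrC mulNr.
apply: is_derive_eq.
by rewrite /= /GRing.scale/=; field.
Qed.

Lemma riemann_sum_error (F f : R -> R) (u c : nat -> R) x N d :
  (forall v w t, v <= t <= w ->
    `|F w - F v - (w - v) * f t| <= `|x| * (w - v) ^+ 2) ->
  (forall i, (i < N)%N -> u i <= c i <= u i.+1 /\ u i.+1 - u i <= d) ->
  `|\sum_(i < N) (u i.+1 - u i) * f (c i) - (F (u N) - F (u 0%N))| <=
    `|x| * d * (u N - u 0%N).
Proof.
move=> Ff; elim: N => [|N IH] uc.
  by rewrite big_ord0 !subrr normr0 mulr0.
rewrite big_ord_recr/=.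
have /IH {}IH : forall i, (i < N)%N -> u i <= c i <= u i.+1 /\ u i.+1 - u i <= d.
  by move=> i iN; apply: uc; rewrite ltnW.
have [ucN ud] := uc N (ltnSn N).
have := Ff _ _ _ ucN.
have : `|x| * (u N.+1 - u N) ^+ 2 <= `|x| * d * (u N.+1 - u N).
  rewrite -mulrA ler_wpM2l// expr2 ler_wpM2r// subr_ge0.
  by case/andP: ucN; exact: le_trans.
move: IH; rewrite !ler_norml => /andP[? ?] ? /andP[? ?].
by apply/andP; split; lra.
Qed.

(** The squared modulus of the integral of [e^{i tau x}] over an interval of
length [T]. *)
Definition fejer_kernel (T x : R) : R :=
  if x == 0 then T ^+ 2 else 2 * (1 - cos (T * x)) / x ^+ 2.

Lemma fejer_kernelE a b x :
  (cosI x b - cosI x a) ^+ 2 + (sinI x b - sinI x a) ^+ 2 =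
  fejer_kernel (b - a) x.
Proof.
rewrite /fejer_kernel /cosI /sinI; have [->|x0] := eqVneq x 0.
  by rewrite invr0 !mulr0 subr0 expr0n addr0.
rewrite mulrBl cosB.
have := cos2Dsin2 (b * x); have := cos2Dsin2 (a * x).
set ca := cos (a * x); set cb := cos (b * x).
set sa := sin (a * x); set sb := sin (b * x) => h1 h2.
apply: (mulIf (expf_neq0 2 x0)).
rewrite divfK ?expf_neq0//.
transitivity (sb ^+ 2 + sa ^+ 2 + cb ^+ 2 + ca ^+ 2 - 2 * (cb * ca + sb * sa)).
  by field.
lra.
Qed.

End RiemannSumError.

(** * Tagged partitions *)

Section TaggedPartition.
Context {R : realType}.
Implicit Types (a b d x : R) (s : seq R) (c : nat -> R) (p : seq (R * R)).

(** The condition on partitions in the definition of the Riemann integral, with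
mesh less than [d]. *)
Definition fine_partition a b d s c := itv_partition a b s /\
  forall i, (i < size s)%N -> nth a (a :: s) i <= c i <= nth a s i /\
    nth a s i - nth a (a :: s) i < d.

Definition tagged_steps a s c : seq (R * R) :=
  [seq (nth a s i - nth a (a :: s) i, c i) | i <- index_iota 0 (size s)].

Lemma big_tagged_steps (V : nmodType) a s c (F : R * R -> V) :
  \sum_(z <- tagged_steps a s c) F z =
  \sum_(i < size s) F (nth a s i - nth a (a :: s) i, c i).
Proof. by rewrite big_map big_mkord. Qed.

Lemma fine_partition_ex a b d : a < b -> 0 < d ->
  exists s c, fine_partition a b d s c.
Proof.
move=> ab d0; pose N := (Num.truncn ((b - a) / d)).+1.
have N0 : (0 : R) < N%:R by rewrite ltr0n.
have Nd : (b - a) / N%:R < d.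
  by rewrite ltr_pdivrMr// mulrC -ltr_pdivrMr// truncnS_gt.
pose t i := a + (b - a) / N%:R * i%:R.
pose s := mkseq (fun i => t i.+1) N.
have sz : size s = N by rewrite size_mkseq.
have ts i : (i <= N)%N -> nth a (a :: s) i = t i.
  case: i => [_|i iN] /=; first by rewrite /t mulr0 addr0.
  by rewrite nth_mkseq.
have tsS i : (i < N)%N -> nth a s i = t i.+1 by exact: (ts i.+1).
have tS i : t i.+1 - t i = (b - a) / N%:R by rewrite /t -natr1; ring.
have step0 : 0 < (b - a) / N%:R by rewrite divr_gt0// subr_gt0.
exists s, (fun i => nth a (a :: s) i); split.
  split; last first.
    by rewrite (last_nth a) sz ts// /t divfK ?lt0r_neq0// subrKC.
  apply/(pathP a) => i; rewrite sz => iN.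
  by rewrite ts 1?ltnW// tsS// -subr_gt0 tS.
move=> i; rewrite sz => iN; rewrite tsS// ts 1?ltnW// tS lexx/=; split => //.
by rewrite -subr_ge0 tS ltW.
Qed.

Variables (a b d : R) (s : seq R) (c : nat -> R).
Hypothesis abs : fine_partition a b d s c.
Let p := tagged_steps a s c.

Let nth_size : nth a (a :: s) (size s) = b.
Proof. by rewrite -last_nth; case: abs => -[_ /eqP]. Qed.

Let steps i : (i < size s)%N -> nth a (a :: s) i <= c i <= nth a (a :: s) i.+1 /\
  nth a (a :: s) i.+1 - nth a (a :: s) i <= d.
Proof. by move=> /(abs.2)[? /ltW]. Qed.

Lemma sum_tagged_steps : \sum_(z <- p) z.1 = b - a.
Proof.
rewrite big_tagged_steps /= -(big_mkord xpredT
  (fun i => nth a (a :: s) i.+1 - nth a (a :: s) i)).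
by rewrite telescope_sumr// nth_size.
Qed.

Lemma sum_norm_tagged_steps : \sum_(z <- p) `|z.1| = b - a.
Proof.
rewrite -sum_tagged_steps !big_tagged_steps; apply: eq_bigr => i _ /=.
have [/andP[ac cb] _] := steps _ (ltn_ord i).
by rewrite ger0_norm// subr_ge0 (le_trans ac).
Qed.

Lemma tcos_error x :
  `|tcos p x - (cosI x b - cosI x a)| <= `|x| * d * (b - a).
Proof.
rewrite /tcos big_tagged_steps -[in cosI x b]nth_size -[X in _ <= _ * (X - _)]nth_size.
apply: (@riemann_sum_error _ (cosI x) (fun t => cos (t * x))
  (nth a (a :: s))) => // v w t.
by apply: (tagged_increment _ cos); [exact: is_derive_cosI|exact: ler_dist_cos].
Qed.

Lemma tsin_error x :
  `|tsin p x - (sinI x b - sinI x a)| <= `|x| * d * (b - a).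
Proof.
rewrite /tsin big_tagged_steps -[in sinI x b]nth_size -[X in _ <= _ * (X - _)]nth_size.
apply: (@riemann_sum_error _ (sinI x) (fun t => sin (t * x))
  (nth a (a :: s))) => // v w t.
by apply: (tagged_increment _ sin); [exact: is_derive_sinI|exact: ler_dist_sin].
Qed.

End TaggedPartition.
Arguments fine_partition_ex {R a b d}.
Arguments sum_tagged_steps {R a b d s c}.
Arguments sum_norm_tagged_steps {R a b d s c}.
Arguments tcos_error {R a b d s c}.
Arguments tsin_error {R a b d s c}.

Section RefiningPartitions.
Context {R : realType}.
Variables (a b : R) (s : nat -> seq R) (c : nat -> nat -> R).
Hypothesis abs : forall n, fine_partition a b n.+1%:R^-1 (s n) (c n).
Let p n := tagged_steps a (s n) (c n).

Let cvg_mesh (F : nat -> R) (l x : R) :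
  (forall n, `|F n - l| <= `|x| * n.+1%:R^-1 * (b - a)) -> F n @[n --> \oo] --> l.
Proof.
move=> Fl; apply/(@subr_cvg0 _ R^o); apply: norm_cvg0.
have c0 : `|x| * n.+1%:R^-1 * (b - a) @[n --> \oo] --> 0.
  rewrite -[X in _ --> X](mul0r (b - a)); apply: cvgMl.
  by rewrite -[X in _ --> X](mulr0 `|x|); apply: cvgMr; exact: cvg_harmonic.
apply: (squeeze_cvgr _ (cvg_cst 0) c0).
by apply: nearW => n; rewrite normr_ge0 Fl.
Qed.

Lemma cvg_tcos x : tcos (p n) x @[n --> \oo] --> cosI x b - cosI x a.
Proof. by apply: (cvg_mesh _ _ x) => n; exact: tcos_error (abs n) x. Qed.

Lemma cvg_tsin x : tsin (p n) x @[n --> \oo] --> sinI x b - sinI x a.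
Proof. by apply: (cvg_mesh _ _ x) => n; exact: tsin_error (abs n) x. Qed.

(** The convergence is only pointwise in [x], because the error bound grows with
[|x|]. *)
Lemma cvg_tsq x : tsq (p n) x @[n --> \oo] --> fejer_kernel (b - a) x.
Proof.
rewrite -fejer_kernelE /tsq !expr2; apply: cvgD; apply: cvgM.
- exact: cvg_tcos.
- exact: cvg_tcos.
- exact: cvg_tsin.
- exact: cvg_tsin.
Qed.

End RefiningPartitions.
Arguments cvg_tcos {R a b s c}.
Arguments cvg_tsin {R a b s c}.
Arguments cvg_tsq {R a b s c}.

(** * Riemann integrals of orbits *)

Lemma measurable_exprN2 {R : realType} :
  measurable_fun setT (fun x : R => x ^- 2).
Proof.
rewrite (_ : (fun x : R => x ^- 2) = (fun x => (x ^+ 2) `^ (-1))); last first.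
  by apply/funext => x; rewrite powR_inv1// sqr_ge0.
apply: (measurableT_comp (@measurable_powR R (-1))).
exact: measurable_funX.
Qed.

Lemma measurable_fejer_kernel {R : realType} (T : R) :
  measurable_fun setT (fejer_kernel T).
Proof.
apply: measurable_fun_ifT => //.
  by apply: measurable_fun_eqr.
apply: measurable_funM; last exact: measurable_exprN2.
apply: measurable_funM => //; apply: measurable_funB => //.
exact: measurable_cosM.
Qed.

Section WaveIntegral.
Context {R : realType} {H : completeNormedModType R[i]}.
Variables (dot : innerProduct H) (U : R -> H -> H) (E : spectralFamily dot).
Hypotheses (hU : unitary_group dot U) (hE : spectral_resolution_of U E).
Implicit Types (f g h v : H) (a b e : R) (p q : seq (R * R)).

Lemma riemann_sumE f a s c :
  riemann_sum (U ^~ f) a s c = wave U (tagged_steps a s c) f.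
Proof. by rewrite /wave big_tagged_steps. Qed.

Definition opp_weights p : seq (R * R) := [seq (- z.1, z.2) | z <- p].

Lemma waveB p q f :
  wave U p f - wave U q f = wave U (p ++ opp_weights q) f.
Proof.
rewrite /wave big_cat big_map/= -sumrN; congr (_ + _); apply: eq_bigr => z _.
by rewrite rmorphN scaleNr.
Qed.

Lemma tcosB p q x : tcos (p ++ opp_weights q) x = tcos p x - tcos q x.
Proof.
rewrite /tcos big_cat big_map/= -sumrN; congr (_ + _); apply: eq_bigr => z _.
by rewrite mulNr.
Qed.

Lemma tsinB p q x : tsin (p ++ opp_weights q) x = tsin p x - tsin q x.
Proof.
rewrite /tsin big_cat big_map/= -sumrN; congr (_ + _); apply: eq_bigr => z _.
by rewrite mulNr.
Qed.

(** Otherwise there would be two sequences of Riemann sums with mesh tending to [0]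
whose differences keep a norm at least [e]. The trigonometric polynomials of these
differences are bounded and tend to [0] pointwise, so their integrals, which are
the squared norms, tend to [0]. *)
Lemma riemann_sum_cauchy a b f e : 0 < e -> exists N : nat,
  forall s c s' c', fine_partition a b N.+1%:R^-1 s c ->
    fine_partition a b N.+1%:R^-1 s' c' ->
  hnorm (riemann_sum (U ^~ f) a s c - riemann_sum (U ^~ f) a s' c') < e.
Proof.
move=> e0; apply: contrapT => /forallNP bad.
have {}bad N : exists r : (seq R * (nat -> R)) * (seq R * (nat -> R)),
    [/\ fine_partition a b N.+1%:R^-1 r.1.1 r.1.2,
        fine_partition a b N.+1%:R^-1 r.2.1 r.2.2 &
        e <= hnorm (riemann_sum (U ^~ f) a r.1.1 r.1.2 -
                    riemann_sum (U ^~ f) a r.2.1 r.2.2)].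
  apply: contrapT => /forallNP good; apply: (bad N) => s c s' c' fs fs'.
  by rewrite ltNge; apply/negP => h; exact: (good ((s, c), (s', c'))).
have [r rP] := choice bad.
pose p n := tagged_steps a (r n).1.1 (r n).1.2.
pose q n := tagged_steps a (r n).2.1 (r n).2.2.
(* The differences of the two Riemann sums, as trigonometric polynomials. *)
pose w n := p n ++ opp_weights (q n).
have fp n : fine_partition a b n.+1%:R^-1 (r n).1.1 (r n).1.2 by case: (rP n).
have fq n : fine_partition a b n.+1%:R^-1 (r n).2.1 (r n).2.2 by case: (rP n).
have w0 x : tsq (w n) x @[n --> \oo] --> 0.
  rewrite (_ : 0 = 0 * 0 + 0 * 0 :> R); last by rewrite mulr0 addr0.
  under eq_cvg do rewrite /tsq tcosB tsinB !expr2.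
  have c0 : tcos (p n) x - tcos (q n) x @[n --> \oo] --> 0.
    rewrite -(subrr (cosI x b - cosI x a)); apply: cvgB; exact: cvg_tcos.
  have s0 : tsin (p n) x - tsin (q n) x @[n --> \oo] --> 0.
    rewrite -(subrr (sinI x b - sinI x a)); apply: cvgB; exact: cvg_tsin.
  by apply: cvgD; apply: cvgM.
have wM n x : `|tsq (w n) x| <= 2 * (2 * (b - a)) ^+ 2.
  rewrite ger0_norm ?tsq_ge0// (le_trans (tsq_le _ _))//.
  rewrite (_ : \sum_(z <- w n) _ = 2 * (b - a))//.
  rewrite /w big_cat [RHS]mulr_natl mulr2n/=; congr (_ + _).
    exact: sum_norm_tagged_steps (fp n).
  rewrite -(sum_norm_tagged_steps (fq n)) [LHS]big_map.
  by apply: eq_bigr => z _; rewrite normrN.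
have := @bounded_cvg_integral _ _ (spectral_measure_fin dot E f) _ (cst 0) _
  (fun n => measurable_tsq (w n)) (measurable_cst _) wM w0.
rewrite integral0 => cvg0.
have : ((e ^+ 2)%:E <= 0)%E.
  rewrite -(cvg_lim _ cvg0)//; apply: lime_ge; first by apply/cvg_ex; eexists; exact: cvg0.
  apply: nearW => n; rewrite -(sqr_hnorm_wave dot U E hU hE) lee_fin.
  rewrite -waveB -!riemann_sumE ler_sqr ?nnegrE ?hnorm_ge0 ?(ltW e0)//.
  by case: (rP n).
by rewrite lee_fin leNgt exprn_gt0.
Qed.

Lemma riemann_integral_ex a b f : a < b ->
  exists v, is_riemann_integral (U ^~ f) a b v.
Proof.
move=> ab.
have inv0 n : (0 : R) < n.+1%:R^-1 by rewrite invr_gt0 ltr0n.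
have part n : exists r : seq R * (nat -> R),
    fine_partition a b n.+1%:R^-1 r.1 r.2.
  by have [s [c sc]] := fine_partition_ex ab (inv0 n); exists (s, c).
have [r rP] := choice part.
pose S n := riemann_sum (U ^~ f) a (r n).1 (r n).2.
have fineW m n s c : (m <= n)%N -> fine_partition a b n.+1%:R^-1 s c ->
    fine_partition a b m.+1%:R^-1 s c.
  move=> mn [abs sc]; split => // i /sc[? sd]; split => //.
  by rewrite (lt_le_trans sd)// lef_pV2 ?posrE ?ltr0n// ler_nat.
have [|v Sv] := hnorm_complete S.
  move=> e /(riemann_sum_cauchy a b f)[N NP]; exists N => m n Nm Nn.
  by apply: NP; apply: fineW (rP _).
exists v => e e0; have e20 : 0 < e / 2 by rewrite divr_gt0.
have [N NP] := riemann_sum_cauchy a b f _ e20.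
exists N.+1%:R^-1 => // s c abs sc.
have /cvgrPdist_lt/(_ _ e20)[M _ SM] := Sv.
pose n := maxn N M.
have Sn : hnorm (S n - v) < e / 2.
  have := SM n (leq_maxr _ _).
  by rewrite /= sub0r normrN ger0_norm ?hnorm_ge0.
rewrite -(subrKA (S n)) (splitr e).
apply: (le_lt_trans (hnormD_le _ _)); apply: ltrD => //.
by apply: NP; [split|apply: fineW (rP _); exact: leq_maxl].
Qed.

(** The weights of a partition of [[a, b]] add up to [b - a], so a Riemann sum for
[f - g] is one for [f] minus [(b - a) g]. Both sides are limits along finer and
finer partitions. *)
Lemma sqr_hnorm_riemann_integral a b f v g : a < b ->
  is_riemann_integral (U ^~ f) a b v -> fixed_vectors U g ->
  ((hnorm (v - (b - a)%:C *: g) ^+ 2)%:E =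
   \int[spectral_measure E (f - g)%R]_x (fejer_kernel (b - a) x)%:E)%E.
Proof.
move=> ab vP fixg.
have inv0 n : (0 : R) < n.+1%:R^-1 by rewrite invr_gt0 ltr0n.
have part n : exists r : seq R * (nat -> R),
    fine_partition a b n.+1%:R^-1 r.1 r.2 /\
    hnorm (riemann_sum (U ^~ f) a r.1 r.2 - v) < n.+1%:R^-1.
  have [d d0 dP] := vP _ (inv0 n).
  have : 0 < Num.min d n.+1%:R^-1 by rewrite lt_min d0/=.
  move=> /(fine_partition_ex ab)[s [c [abs sc]]].
  exists (s, c); split=> /=.
    by split => // i /sc[?]; rewrite lt_min => /andP[].
  by apply: dP => // i /sc[?]; rewrite lt_min => /andP[].
have [r rP] := choice part.
pose p n := tagged_steps a (r n).1 (r n).2.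
have fp n : fine_partition a b n.+1%:R^-1 (r n).1 (r n).2 by case: (rP n).
have waveE n : wave U (p n) (f - g) = wave U (p n) f - (b - a)%:C *: g.
  rewrite /wave -(sum_tagged_steps (fp n)) rmorph_sum scaler_suml -sumrB.
  apply: eq_bigr => z _.
  by rewrite (linear_predB (ugroup_linear hU z.2)) scalerBr fixg.
have cl : (hnorm (wave U (p n) (f - g)) ^+ 2)%:E @[n --> \oo] -->
    (hnorm (v - (b - a)%:C *: g) ^+ 2)%:E.
  have cw : hnorm (wave U (p n) (f - g)) @[n --> \oo] -->
      hnorm (v - (b - a)%:C *: g).
    apply: cvg_hnorm.
    apply: (squeeze_cvgr _ (cvg_cst 0) (@cvg_harmonic R)).
    apply: nearW => n; rewrite hnorm_ge0 waveE /=.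
    rewrite opprB subrKA -riemann_sumE.
    by rewrite ltW//; case: (rP n).
  apply/cvg_EFin; first exact: nearW.
  under eq_cvg do rewrite /= expr2.
  by rewrite expr2; exact: cvgM.
have cr : (hnorm (wave U (p n) (f - g)) ^+ 2)%:E @[n --> \oo] -->
    (\int[spectral_measure E (f - g)%R]_x (fejer_kernel (b - a) x)%:E)%E.
  under eq_cvg do rewrite (sqr_hnorm_wave dot U E hU hE).
  apply: (@bounded_cvg_integral _ _ (spectral_measure_fin dot E _) _ _
    (2 * (b - a) ^+ 2)).
  - by move=> n; exact: measurable_tsq.
  - exact: measurable_fejer_kernel.
  - move=> n x; rewrite ger0_norm ?tsq_ge0// (le_trans (tsq_le _ _))//.
    by rewrite (sum_norm_tagged_steps (fp n)).
  - by move=> x; apply: cvg_tsq.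
exact: (cvg_unique _ cl cr).
Qed.

End WaveIntegral.

(** * The spectral mass at the origin *)

Section FixedVectors.
Context {R : realType} {H : completeNormedModType R[i]}.
Variables (dot : innerProduct H) (U : R -> H -> H) (E : spectralFamily dot).
Hypotheses (hU : unitary_group dot U) (hE : spectral_resolution_of U E).
Implicit Types (f g h u v : H) (a b l t : R).

Lemma rdot_sfam_ge h a b : a <= b -> rdot dot (E b h) (E a h) = sdistr E h a.
Proof.
move=> ab; rewrite /rdot -(oproj_selfadj (sfam_proj E a)) sfam_min min_l//.
Qed.

Lemma sqr_hnorm_sfamB h a b : a <= b ->
  hnorm (E b h - E a h) ^+ 2 = sdistr E h b - sdistr E h a.
Proof.
move=> ab; rewrite (sqr_hnormB dot) rdot_sfam_ge// -!sdistrE.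
by ring.
Qed.

(** The spectral measure of such a vector is a point mass at [0], so
[Re (U^t u, u) = ||u||^2] for every [t]; hence [||U^t u - u|| = 0]. *)
Lemma sdistr_jump u : (forall l, 0 <= l -> E l u = u) ->
  (forall l, l < 0 -> E l u = 0) -> fixed_vectors U u.
Proof.
move=> Epos Eneg t.
have null a b : a <= b -> (b < 0) || (0 <= a) ->
    spectral_measure E u `]a, b]%classic = 0%E.
  move=> ab /orP[b0|a0]; rewrite spectral_measure_itv// !sdistrE.
    by rewrite !Eneg ?(le_lt_trans ab)// subrr.
  by rewrite !Epos ?(le_trans a0)// subrr.
have ae0 : {ae spectral_measure E u, forall x : R, x = 0}.
  (* The intervals of [B n] avoid [0], and together they cover its complement. *)
  pose B n : set R := `]- n.+1%:R, - n.+1%:R^-1] `|` `]0, n%:R].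
  have B0 n : (spectral_measure E u).-negligible (B n).
    apply: negligibleU.
      exists (`]- n.+1%:R, - n.+1%:R^-1]%classic); split => //.
      apply: null; last by rewrite oppr_lt0 invr_gt0 ltr0n.
      by rewrite lerN2 (@le_trans _ _ 1)// ?invf_le1// ?ler1n ?ltr0n.
    exists (`]0, n%:R]%classic); split => //.
    by apply: null; rewrite ?lexx ?orbT.
  have := negligible_bigcup B0; apply: negligibleS.
  move=> x /= /eqP; rewrite neq_lt => /orP[x0|x0].
    (* [n + 1] has to exceed both [|x|] and [1 / |x|]. *)
    pose n := maxn (Num.truncn `|x|) (Num.truncn `|x^-1|).
    have bnd (y : R) k : (Num.truncn `|y| <= k)%N -> `|y| < k.+1%:R.
      by move=> yk; rewrite (lt_le_trans (truncnS_gt _))// ler_nat.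
    exists n => //; left; rewrite /= in_itv/= ltrNl.
    rewrite -[X in X < _ ](ltr0_norm x0) bnd ?leq_maxl//= lerNr.
    rewrite -[leRHS]invrK lef_pV2 ?posrE ?ltr0n ?invr_gt0 ?oppr_gt0//.
    by rewrite invrN -ltr0_norm ?invr_lt0// ltW// bnd// leq_maxr.
  exists (Num.truncn x).+1 => //; right => /=.
  by rewrite in_itv/= x0 ltW// truncnS_gt.
have cosE s : rdot dot (U s u) u = hnorm u ^+ 2.
  have := rdotU_cos dot U E hU hE 0 u; rewrite (ugroup0 hU) (rdotff dot) => ->.
  rewrite (rdotU_cos dot U E hU hE) /Rintegral; congr fine; apply: ae_eq_integral => //.
  - by apply/measurable_EFinP; exact: measurable_cosM.
  - by apply/measurable_EFinP; exact: measurable_cosM.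
  - apply: (negligibleS _ ae0) => x /= ne x0; apply: ne => _.
    by rewrite x0 !mulr0.
apply/eqP; rewrite -subr_eq0; apply/eqP/hnorm0_eq0/eqP.
rewrite -sqrf_eq0 (sqr_hnormB dot) cosE -!(rdotff dot) rdotUU// subrr.
by rewrite (ugroup0 hU); apply/eqP; ring.
Qed.

(** The increments [w n] of the spectral family of [h] over [`]-1/(n+1), 0]] converge
to a vector [u] whose spectral family jumps only at [0], hence to a fixed vector.
As [||h - w n||^2 = ||h||^2 - ||w n||^2], the limit satisfies
[||h - u||^2 = ||h||^2 - ||u||^2], and orthogonality of [h] and [u] forces
[u = 0]. The mass at [0] is at most [||w n||^2] for every [n]. *)
Lemma spectral_measure_set0 h :
  (forall u, fixed_vectors U u -> rdot dot h u = 0) ->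
  spectral_measure E h [set 0] = 0%E.
Proof.
move=> h_fixed.
pose m n : R := - n.+1%:R^-1.
have m_lt0 n : m n < 0 by rewrite /m oppr_lt0 invr_gt0 ltr0n.
have m_le : {homo m : i j / (i <= j)%N >-> i <= j}.
  by move=> i j ij; rewrite lerN2 lef_pV2 ?posrE ?ltr0n// ler_nat.
pose w n := E 0 h - E (m n) h.
have w2 n : hnorm (w n) ^+ 2 = sdistr E h 0 - sdistr E h (m n).
  by rewrite sqr_hnorm_sfamB// ltW.
have [u wu] : exists u, hnorm (w n - u) @[n --> \oo] --> 0.
  apply: hnorm_complete => e e0.
  have : cvg (sdistr E h (m n) @[n --> \oo]).
    apply: nondecreasing_is_cvgn.
      by move=> i j ij; exact/sdistr_nondecreasing/m_le.
    by exists (hnorm h ^+ 2) => _ [n _ <-]; exact: sdistr_le.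
  move=> /cvg_ex[l /cvgrPdist_lt/(_ (e ^+ 2 / 2))].
  rewrite divr_gt0 ?exprn_gt0// => /(_ isT)[N _ Nl].
  exists N => i j Ni Nj.
  wlog ij : i j Ni Nj / (i <= j)%N.
    by move=> hw; have [/hw|/ltnW/hw] := leqP i j; [|rewrite hnormBC]; apply.
  rewrite -(@ltr_pXn2r _ 2)// ?nnegrE ?hnorm_ge0 ?(ltW e0)//.
  rewrite /w opprB addrC subrKA sqr_hnorm_sfamB ?m_le//.
  have /= := Nl i Ni; have /= := Nl j Nj; rewrite !ltr_norml.
  move=> /andP[? ?] /andP[? ?]; lra.
have Ew l g : hnorm (E l u - g) = 0 -> E l u = g.
  by move=> /hnorm0_eq0/eqP; rewrite subr_eq0 => /eqP.
(* [E l] is a contraction and [E l (w n)] is eventually [w n] or [0], so [E l u] is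
   at distance at most a multiple of [||w n - u||] from [u] or from [0]. *)
have squeeze0 (x k : R) : 0 <= x ->
    (\forall n \near \oo, x <= k * hnorm (w n - u)) -> x = 0.
  move=> x0 xw; apply/eqP; rewrite eq_le x0 andbT.
  have kw : k * hnorm (w n - u) @[n --> \oo] --> 0.
    by rewrite -(mulr0 k); apply: cvgMr.
  rewrite -(cvg_lim _ kw)//; apply: limr_ge => //.
  by apply/cvg_ex; exists 0.
have contr l g : hnorm (E l g) <= hnorm g by exact/oproj_hnorm_le/sfam_proj.
have linE l := oproj_linear (sfam_proj E l).
have fixu : fixed_vectors U u.
  apply: sdistr_jump => l l0.
    apply: Ew; apply: (squeeze0 _ 2); first exact: hnorm_ge0.
    apply: nearW => n.
    have Elw : E l (w n) = w n.
      by rewrite /w (linear_predB (linE l)) !sfam_min !min_r// ltW// (lt_le_trans (m_lt0 n)).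
    rewrite (_ : E l u - u = (w n - u) - E l (w n - u)); last first.
      by rewrite (linear_predB (linE l)) Elw opprB [RHS]addrC subrKA.
    rewrite (le_trans (hnormD_le _ _))// mulr_natl mulr2n lerD2l.
    by rewrite -[leLHS]/(hnorm (- _)) /hnorm normrN contr.
  apply: Ew; rewrite subr0; apply: (squeeze0 _ 1); first exact: hnorm_ge0.
  near=> n; rewrite mul1r.
  have ln : l <= m n.
    near: n; exists (Num.truncn (- l^-1)) => // n /= ln.
    rewrite /m lerNr -[leRHS]invrK lef_pV2 ?posrE ?ltr0n ?invr_gt0 ?oppr_gt0//.
    by rewrite invrN ltW// (lt_le_trans (truncnS_gt _))// ler_nat.
  have Elw : E l (w n) = 0.
    by rewrite /w (linear_predB (linE l)) !sfam_min !min_l ?subrr// ltW.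
  by rewrite hnormBC (le_trans _ (contr l _))// (linear_predB (linE l)) Elw subr0.
have wn n : hnorm (h - w n) ^+ 2 = hnorm h ^+ 2 - hnorm (w n) ^+ 2.
  rewrite (sqr_hnormB dot) w2 /w rdotDr rdotNr /sdistr.
  rewrite !(rdotC dot h) /rdot; ring.
have cvg_sqr v' (v_ : nat -> H) : hnorm (v_ n - v') @[n --> \oo] --> 0 ->
    hnorm (v_ n) ^+ 2 @[n --> \oo] --> hnorm v' ^+ 2.
  move=> /cvg_hnorm vv; under eq_cvg do rewrite expr2.
  by rewrite expr2; exact: cvgM.
have u0 : hnorm u ^+ 2 = 0.
  have c1 : hnorm (h - w n) ^+ 2 @[n --> \oo] --> hnorm (h - u) ^+ 2.
    apply: (cvg_sqr _ (fun n => h - w n)); move: wu; apply: cvg_trans.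
    apply: near_eq_cvg; apply: nearW => n /=.
    by rewrite (hnormBC (h - w n)) opprB [in RHS]addrC subrKA.
  have c2 : hnorm (h - w n) ^+ 2 @[n --> \oo] --> hnorm h ^+ 2 - hnorm u ^+ 2.
    under eq_cvg do rewrite wn; apply: cvgB; first exact: cvg_cst.
    exact: cvg_sqr.
  have : hnorm (h - u) ^+ 2 = hnorm h ^+ 2 - hnorm u ^+ 2.
    exact: (cvg_unique _ c1 c2).
  by rewrite (sqr_hnormB dot) h_fixed//; lra.
have w0 : (hnorm (w n) ^+ 2)%:E @[n --> \oo] --> 0%E.
  apply/cvg_EFin; first exact: nearW.
  by rewrite -u0; exact: cvg_sqr.
apply/eqP; rewrite -measure_le0 -(cvg_lim _ w0)//; apply: lime_ge.
  by apply/cvg_ex; eexists; exact: w0.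
apply: nearW => n; rewrite w2 -(spectral_measure_itv dot E) ?(ltW (m_lt0 n))//.
apply: le_measure; rewrite ?inE.
- exact: measurable_set1.
- exact: measurable_itv.
- by move=> _ ->; rewrite /= in_itv/= m_lt0 lexx.
Unshelve. all: by end_near.
Qed.

End FixedVectors.

Lemma rdot_orthogonal_projection {R : realType} {H : completeNormedModType R[i]}
    (dot : innerProduct H) (V : set H) (P : H -> H) f u :
  orthogonal_projection_onto dot V P -> V u -> rdot dot (f - P f) u = 0.
Proof.
move=> [[lP iP sP] <-] [v _ <-].
by rewrite /rdot -sP (linear_predB lP) iP subrr linear0l.
Qed.

(** * Averages of the kernel over the length of the time interval *)

Section FejerKernel.
Context {R : realType}.
Implicit Types (x T : R) (n : nat).

Lemma fejer_kernel_ge0 T x : 0 <= fejer_kernel T x.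
Proof.
rewrite /fejer_kernel; case: ifP => _; first exact: sqr_ge0.
by rewrite divr_ge0 ?sqr_ge0// mulr_ge0// subr_ge0 cos_le1.
Qed.

Lemma fejer_kernel_le T x : x != 0 -> fejer_kernel T x <= 4 * x ^- 2.
Proof.
move=> x0; rewrite /fejer_kernel (negbTE x0) ler_wpM2r ?invr_ge0 ?sqr_ge0//.
have := cos_geN1 (T * x); lra.
Qed.

(** The value at [x = 0] is [0], whereas [fejer_kernel T] takes the value [T^2] there,
which would not stay bounded under the averages. *)
Definition chord_kernel T x := 2 * (1 - cos (T * x)) * x ^- 2.

Lemma chord_kernel_ge0 T x : 0 <= chord_kernel T x.
Proof.
by rewrite mulr_ge0 ?invr_ge0 ?sqr_ge0// mulr_ge0// subr_ge0 cos_le1.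
Qed.

Lemma chord_kernel_le T x : chord_kernel T x <= fejer_kernel T x.
Proof.
rewrite /fejer_kernel; case: eqVneq => [->|//].
by rewrite /chord_kernel expr0n invr0 mulr0 sqr_ge0.
Qed.

Lemma measurable_chord_kernel T : measurable_fun setT (chord_kernel T).
Proof.
apply: measurable_funM; last exact: measurable_exprN2.
apply: measurable_funM => //; apply: measurable_funB => //.
exact: measurable_cosM.
Qed.

(** The mean of [cos (T x)] over [T = k / (n + 1)], [1 <= k <= (n + 1)^2]: the times
fill [[0, n + 1]] with step [1 / (n + 1)]. *)
Definition mean_cos n x : R :=
  (n.+1%:R ^+ 2)^-1 * \sum_(k < n.+1 ^ 2) cos (k.+1%:R / n.+1%:R * x).

(** Multiplied by [n + 1], the mean is a Riemann sum over [[0, n + 1]] whose error is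
at most [|x|], and the integral itself is at most [1 / |x|] in absolute value. *)
Lemma cvg_mean_cos x : x != 0 -> mean_cos n x @[n --> \oo] --> 0.
Proof.
move=> x0; apply: norm_cvg0.
have c0 : n.+1%:R^-1 * (`|x| + `|x|^-1) @[n --> \oo] --> 0.
  by rewrite -[X in _ --> X](mul0r (`|x| + `|x|^-1)); apply: cvgMl; exact: cvg_harmonic.
apply: (squeeze_cvgr _ (cvg_cst 0) c0); apply: nearW => n; rewrite normr_ge0/=.
have M0 : (0 : R) < n.+1%:R by rewrite ltr0n.
have step i : i.+1%:R / n.+1%:R - i%:R / n.+1%:R = n.+1%:R^-1 :> R.
  by rewrite -mulrBl -natr1 addrAC subrr add0r mul1r.
have sqE : (n.+1 ^ 2)%:R / n.+1%:R = n.+1%:R :> R.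
  by rewrite natrX expr2 mulfK// gt_eqF.
pose u i : R := i%:R / n.+1%:R.
have err : `|\sum_(i < n.+1 ^ 2) (u i.+1 - u i) * cos (u i.+1 * x) -
      (cosI x (u (n.+1 ^ 2)%N) - cosI x (u 0%N))| <=
    `|x| * n.+1%:R^-1 * (u (n.+1 ^ 2)%N - u 0%N).
  apply: (@riemann_sum_error R (cosI x) (fun t => cos (t * x)) u
    (fun i => u i.+1)) => [v w t|i _].
    by apply: (tagged_increment _ cos); [exact: is_derive_cosI|exact: ler_dist_cos].
  by rewrite /u step !lexx andbT ler_wpM2r ?invr_ge0 ?ler_nat// ltW.
move: err; rewrite /u sqE; under eq_bigr do rewrite step; rewrite -mulr_sumr.
rewrite /cosI (negbTE x0) !mul0r sin0 mul0r !subr0.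
rewrite -[X in _ <= X -> _]mulrA mulVf ?gt_eqF// mulr1 => err.
rewrite /mean_cos expr2 invfM -mulrA normrM gtr0_norm ?invr_gt0// ler_wpM2l//.
set S := n.+1%:R^-1 * _ in err *.
have : `|sin (n.+1%:R * x) / x| <= `|x|^-1.
  by rewrite normrM normfV ler_piMl ?invr_ge0// normr_sin_le1.
move: err; rewrite !ler_norml => /andP[? ?] /andP[? ?].
by apply/andP; split; lra.
Qed.

Lemma mean_chord_kernelE n x :
  \sum_(k < n.+1 ^ 2) (n.+1%:R ^+ 2)^-1 * chord_kernel (k.+1%:R / n.+1%:R) x =
  2 * (1 - mean_cos n x) * x ^- 2.
Proof.
rewrite /chord_kernel.
under eq_bigr do rewrite mulrA; rewrite -mulr_suml; congr (_ * _).
under eq_bigr do rewrite mulrCA; rewrite -mulr_sumr; congr (_ * _).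
rewrite -mulr_sumr sumrB mulrBr -/(mean_cos n x); congr (_ - _).
by rewrite sumr_const card_ord natrX mulVf// expf_neq0// pnatr_eq0.
Qed.

Lemma cvg_mean_chord_kernel x :
  2 * (1 - mean_cos n x) * x ^- 2 @[n --> \oo] --> 2 * x ^- 2.
Proof.
have [->|x0] := eqVneq x 0.
  under eq_cvg do rewrite expr0n invr0 mulr0.
  by rewrite expr0n invr0 mulr0; exact: cvg_cst.
apply: cvgMl; rewrite -[X in _ --> X]mulr1; apply: cvgMr.
rewrite -[X in _ --> X](subr0 1); apply: cvgB; first exact: cvg_cst.
exact: cvg_mean_cos.
Qed.

End FejerKernel.

(** Each average of [chord_kernel] satisfies the same bound as its terms, and these
averages converge pointwise to [2 / x^2]; Fatou's lemma concludes. *)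
Lemma integral_exprN2_le {R : realType}
    (mu : {measure set (measurableTypeR R) -> \bar R}) (K : R) :
  (forall T, 0 < T -> (\int[mu]_x (fejer_kernel T x)%:E <= K%:E)%E) ->
  (\int[mu]_x (2 * x ^- 2)%:E <= K%:E)%E.
Proof.
move=> muK; pose F n x := 2 * (1 - mean_cos n x) * x ^- 2 : R.
have chordK T : 0 < T -> (\int[mu]_x (chord_kernel T x)%:E <= K%:E)%E.
  move=> /muK; apply: le_trans; apply: ge0_le_integral => //.
  - by move=> x _; rewrite lee_fin chord_kernel_ge0.
  - by apply/measurable_EFinP; exact: measurable_chord_kernel.
  - by apply/measurable_EFinP; exact: measurable_fejer_kernel.
  - by move=> x _; rewrite lee_fin chord_kernel_le.
have intF n : (\int[mu]_x (F n x)%:E <= K%:E)%E.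
  pose c k x : R := (n.+1%:R ^+ 2)^-1 * chord_kernel (k.+1%:R / n.+1%:R) x.
  have mc k : measurable_fun setT (c k).
    by apply: measurable_funM => //; exact: measurable_chord_kernel.
  have c0 k x : 0 <= c k x.
    by rewrite mulr_ge0 ?chord_kernel_ge0// invr_ge0 sqr_ge0.
  have -> : (\int[mu]_x (F n x)%:E =
      \int[mu]_x \sum_(k < n.+1 ^ 2) (c k x)%:E)%E.
    by apply: eq_integral => x _; rewrite sumEFin /F -mean_chord_kernelE.
  rewrite ge0_integral_sum//; last 2 first.
    by move=> k; apply/measurable_EFinP; exact: mc.
    by move=> k x _; rewrite lee_fin.
  have -> : K = \sum_(k < n.+1 ^ 2) ((n.+1%:R ^+ 2)^-1 * K).
    rewrite sumr_const card_ord -[RHS]mulr_natl natrX mulrA mulfV ?mul1r//.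
  rewrite -sumEFin; apply: lee_sum => k _.
  under eq_integral do rewrite /c EFinM.
  rewrite ge0_integralZl_EFin//; last 2 first.
  - by move=> x _; rewrite lee_fin chord_kernel_ge0.
  - by apply/measurable_EFinP; exact: measurable_chord_kernel.
  rewrite EFinM lee_wpmul2l ?lee_fin ?invr_ge0 ?sqr_ge0//.
  by apply: chordK; rewrite divr_gt0 ?ltr0n.
have mF n : measurable_fun setT (EFin \o F n).
  apply/measurable_EFinP.
  rewrite (_ : F n = fun x => \sum_(k < n.+1 ^ 2)
    (n.+1%:R ^+ 2)^-1 * chord_kernel (k.+1%:R / n.+1%:R) x).
    apply: measurable_sum => k.
    by apply: measurable_funM => //; exact: measurable_chord_kernel.
  by apply/funext => x; rewrite /F -mean_chord_kernelE.
have F0 n x : (0 <= (F n x)%:E)%E.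
  rewrite lee_fin /F -mean_chord_kernelE sumr_ge0// => k _.
  by rewrite mulr_ge0 ?chord_kernel_ge0// invr_ge0 sqr_ge0.
have cF x : (F n x)%:E @[n --> \oo] --> (2 * x ^- 2)%:E.
  by apply/cvg_EFin; [exact: nearW|exact: cvg_mean_chord_kernel].
have -> : (\int[mu]_x (2 * x ^- 2)%:E =
    \int[mu]_x limn_einf (fun n => (F n x)%:E))%E.
  apply: eq_integral => x _; rewrite is_cvg_limn_einfE.
    by apply/esym/cvg_lim => //; exact: cF.
  by apply/cvg_ex; eexists; exact: cF.
have := @fatou _ _ _ mu setT measurableT (fun n x => (F n x)%:E) mF (fun n x _ => F0 n x).
move=> /le_trans; apply.
rewrite limn_einf_lim; apply: lime_le; first exact: is_cvg_einfs.
apply: nearW => n; apply: le_trans (intF n).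
by apply: ereal_inf_lbound; exists n => /=.
Qed.

(** * The two inequalities *)

(** Both integrands may be restricted to the complement of [0], where
[1 - cos (T x) <= 2]. *)
Lemma integral_fejer_kernel_le {R : realType}
    (mu : {measure set (measurableTypeR R) -> \bar R}) (T : R) :
  mu [set 0%R] = 0%E ->
  (\int[mu]_x (fejer_kernel T x)%:E <= 4%:E * \int[mu]_x (x ^- 2)%:E)%E.
Proof.
move=> mu0; have m0 : measurable [set 0%R : measurableTypeR R].
  exact: measurable_set1.
have mK : measurable_fun setT (EFin \o fejer_kernel T).
  by apply/measurable_EFinP; exact: measurable_fejer_kernel.
have mX : measurable_fun setT (EFin \o (fun x : R => x ^- 2)).
  by apply/measurable_EFinP; exact: measurable_exprN2.
have X0 (x : R) : (0 <= (x ^- 2)%:E)%E by rewrite lee_fin invr_ge0 sqr_ge0.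
rewrite (ge0_negligible_integral m0)//; last first.
  by move=> x _; rewrite lee_fin fejer_kernel_ge0.
rewrite -ge0_integralZl_EFin//.
rewrite (ge0_negligible_integral m0 measurableT _ _ mu0); last 2 first.
- by apply: measurable_funeM.
- by move=> x _; rewrite mule_ge0.
apply: ge0_le_integral => //.
- exact: measurableD.
- by move=> x _; rewrite lee_fin fejer_kernel_ge0.
- exact: measurable_funS mK.
- by apply: measurable_funeM; exact: measurable_funS mX.
- by move=> x [_ /eqP x0]; rewrite -EFinM lee_fin fejer_kernel_le.
Qed.

Section TimeAverage.
Context {R : realType} {H : completeNormedModType R[i]}.
Variables (dot : innerProduct H) (U : R -> H -> H) (E : spectralFamily dot).
Hypotheses (hU : unitary_group dot U) (hE : spectral_resolution_of U E).

Lemma sqr_hnorm_time_average (s t : R) (f g : H) : s < t -> fixed_vectors U g ->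
  ((((t - s) * hnorm (time_average U t s f - g)) ^+ 2)%:E =
   \int[spectral_measure E (f - g)%R]_x (fejer_kernel (t - s) x)%:E)%E.
Proof.
move=> st fixg.
have := getPex (riemann_integral_ex dot U E hU hE s t f st).
rewrite -/(riemann_integral (U ^~ f) s t) => vP.
rewrite -(sqr_hnorm_riemann_integral dot U E hU hE _ _ _ _ _ st vP fixg).
congr (_ ^+ 2)%:E; have T0 : 0 < t - s by rewrite subr_gt0.
rewrite -{1}(gtr0_norm T0) -hnormZ scalerBr /time_average scalerA -rmorphM/=.
by rewrite mulfV ?gt_eqF// scale1r.
Qed.

End TimeAverage.

Section OperatorNorm.
Context {R : realType} {H : completeNormedModType R[i]}.
Variables (X : {pred H}) (nX : H -> R) (T : H -> H).
Hypothesis hnX : norm_on X nX.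

Lemma norm_on_gt0 (f : H) : f \in X -> f != 0 -> 0 < nX f.
Proof.
move=> fX f0; rewrite lt_def (norm_on_ge0 hnX)// andbT.
by apply: contra_neq f0; exact: (norm_on_eq0 hnX).
Qed.

Lemma opnorm_sqr_le (c : R) : 0 <= c ->
  (forall f, f \in X -> hnorm (T f) <= c * nX f) ->
  (opnorm X nX T ^+ 2 <= (c ^+ 2)%:E)%E.
Proof.
move=> c0 Tc.
have opn0 : (0 <= opnorm X nX T)%E by apply: ereal_sup_ubound; left.
have opnc : (opnorm X nX T <= c%:E)%E.
  apply: ge_ereal_sup => _ [->|[f [fX f0] <-]]; first by rewrite lee_fin.
  by rewrite lee_fin ler_pdivrMr ?norm_on_gt0// Tc.
by rewrite EFin_expe !expe2 lee_pmul.
Qed.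

Lemma opnorm_sqr_ge (c : R) (f : H) :
  (opnorm X nX T ^+ 2 <= c%:E)%E -> f \in X -> f != 0 ->
  hnorm (T f) ^+ 2 <= c * nX f ^+ 2.
Proof.
move=> opc fX f0; have n0 := norm_on_gt0 _ fX f0.
rewrite -ler_pdivrMr ?exprn_gt0// -expr_div_n -lee_fin.
apply: le_trans opc; rewrite EFin_expe !expe2.
have q0 : (0 <= (hnorm (T f) / nX f)%:E)%E.
  by rewrite lee_fin divr_ge0 ?hnorm_ge0// ltW.
have qle : ((hnorm (T f) / nX f)%:E <= opnorm X nX T)%E.
  by apply: ereal_sup_ubound; right; exists f.
by rewrite lee_pmul.
Qed.

End OperatorNorm.

Theorem mainTheorem4 (R : realType) (H : completeNormedModType R[i])
    (dot : innerProduct H)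
    (U : R -> H -> H) (hU : unitary_group dot U)
    (P : H -> H) (hP : orthogonal_projection_onto dot (fixed_vectors U) P)
    (E : spectralFamily dot) (hE : spectral_resolution_of U E)
    (X : {pred H}) (hX : GRing.submod_closed X)
    (nX : H -> R) (hnX : norm_on X nX) :
  (forall A : R, 0 < A ->
    (forall f : H, f \in X ->
      (\int[spectral_measure E (f - P f)%R]_x (x ^- 2)%:E
         <= (A * nX f ^+ 2)%:E)%E) ->
    forall t s : R, s < t ->
      (opnorm X nX (fun f => time_average U t s f - P f)%R ^+ 2
         <= ((4 * A) * (t - s) ^- 2)%:E)%E) /\
  (forall B : R, 0 < B ->
    (forall t s : R, s < t ->
      (opnorm X nX (fun f => time_average U t s f - P f)%R ^+ 2
         <= (B * (t - s) ^- 2)%:E)%E) ->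
    forall f : H, f \in X ->
      (\int[spectral_measure E (f - P f)%R]_x (x ^- 2)%:E
         <= ((8 * B) * nX f ^+ 2)%:E)%E).
Proof.
have fixP f : fixed_vectors U (P f) by case: hP => _ <-; exists f.
have mass0 f : spectral_measure E (f - P f) [set 0] = 0%E.
  apply: (spectral_measure_set0 dot U E hU hE) => u.
  exact: rdot_orthogonal_projection hP.
split=> [A A0 intA t s st|B B0 opB f fX].
  have T0 : 0 < t - s by rewrite subr_gt0.
  have AE : 4 * A * (t - s) ^- 2 = (Num.sqrt (4 * A) / (t - s)) ^+ 2.
    by rewrite expr_div_n sqr_sqrtr// mulr_ge0// ltW.
  rewrite AE; apply: opnorm_sqr_le => // [|f fX].
    by rewrite divr_ge0 ?sqrtr_ge0// ltW.
  have n0 := norm_on_ge0 hnX fX.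
  rewrite mulrAC ler_pdivlMr// mulrC.
  rewrite -(@ler_pXn2r _ 2)// ?nnegrE ?mulr_ge0 ?hnorm_ge0 ?sqrtr_ge0 ?(ltW T0)//.
  rewrite [leRHS]exprMn sqr_sqrtr ?mulr_ge0 ?(ltW A0)// -lee_fin.
  rewrite (sqr_hnorm_time_average dot U E hU hE)//.
  apply: (le_trans (integral_fejer_kernel_le _ _ (mass0 f))).
  by rewrite -mulrA EFinM lee_wpmul2l ?lee_fin//; exact: intA.
have [f0|f0] := eqVneq f 0.
  rewrite f0 (_ : 0 - P 0 = 0).
    rewrite integral_spectral_measure0 lee_fin mulr_ge0 ?sqr_ge0//.
    by rewrite mulr_ge0// ltW.
  have P0 := linear_predB (oproj_linear hP.1) 0 0.
  by rewrite subrr subrr in P0; rewrite P0 subrr.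
have X0 (x : R) : (0 <= (x ^- 2)%:E)%E by rewrite lee_fin invr_ge0 sqr_ge0.
have mX : measurable_fun setT (EFin \o (fun x : R => x ^- 2)).
  by apply/measurable_EFinP; exact: measurable_exprN2.
have le2 : (\int[spectral_measure E (f - P f)%R]_x (2 * x ^- 2)%:E
    <= (B * nX f ^+ 2)%:E)%E.
  apply: integral_exprN2_le => T T0.
  have := sqr_hnorm_time_average dot U E hU hE 0 T f _ T0 (fixP f).
  rewrite subr0 => <-; rewrite lee_fin exprMn.
  have := opnorm_sqr_ge _ _ _ hnX _ _ (opB _ _ T0) fX f0.
  rewrite subr0 mulrAC ler_pdivlMr ?exprn_gt0// mulrC; exact.
apply: (@le_trans _ _ (B * nX f ^+ 2)%:E).
  apply: le_trans le2; apply: ge0_le_integral => //.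
    by apply/measurable_EFinP; apply: measurable_funM => //; exact: measurable_exprN2.
  move=> x _; rewrite lee_fin ler_peMl ?invr_ge0 ?sqr_ge0//.
  by rewrite ler1n.
rewrite lee_fin -mulrA ler_peMl// ?ler1n// mulr_ge0 ?sqr_ge0// ltW//.
Qed.
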